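(* Let $G=(V,E)$ be a multigraph with $m$ edges (loops counted). Let $\mathcal P$ be the poset, ordered by inclusion, of all subsets $H\subseteq E$ such that the graph $(V,H)$ has no bridge (equivalently, $H$ is a union of cycles of $G$; $\emptyset\in\mathcal P$), and let $\mu(H)=\mu_{\mathcal P}(\emptyset,H)$ be its Möbius function. Then $$h^\ast(\mathcal C_G;z)=\sum_{H\in\mathcal P}\mu(H)\,(2z)^{|H|}(1+3z)^{m-|H|}.$$
   Context: For a finite undirected multigraph $G=(V,E)$ (loops, parallel edges and isolated nodes allowed) with $n=|V|$, $m=|E|$, work in $\mathbb{R}^V\times\mathbb{R}^E\cong\mathbb{R}^{n+m}$ with standard basis vectors $e_u$, $e_f$. For each edge $f$ with endpoints $u,v$ ($u=v$ for a loop) set $\widetilde e_f=e_u+e_v-e_f$, $\overleftarrow e_f=e_u-e_v+e_f$, $\overrightarrow e_f=-e_u+e_v+e_f$. The cosmological polytope $\mathcal C_G$ is the convex hull of $\{e_f,\widetilde e_f,\overleftarrow e_f,\overrightarrow e_f: f\in E\}\cup\{e_u: u\in V\}$, a lattice polytope of dimension $n+m-1$. For a $d$-dimensional lattice polytope $P\subseteq\mathbb{R}^N$, the $h^\ast$-polynomial is defined by $\sum_{j\ge0}|jP\cap\mathbb{Z}^N|z^j=h^\ast(P;z)/(1-z)^{d+1}$. The Möbius function of a finite poset is the unique $\mu$ with $\mu(s,s)=1$, $\mu(s,t)=0$ unless $s\le t$, and $\sum_{s\le r\le t}\mu(s,r)=0$ for $s<t$. *)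

(* Defs.v *)
From HB Require Import structures.
From mathcomp Require Import all_boot all_order all_algebra.
From mathcomp Require Import reals.
Set Implicit Arguments. Unset Strict Implicit. Unset Printing Implicit Defensive.
Import Order.TTheory GRing.Theory Num.Theory.
Local Open Scope ring_scope.

Section Polytope.
Variables (R : realType) (N : nat).

Definition in_conv (S : seq 'rV[R]_N) (p : 'rV[R]_N) : Prop :=
  exists lam : 'I_(size S) -> R,
    (forall i, 0 <= lam i) /\ \sum_(i < size S) lam i = 1 /\
    p = \sum_(i < size S) lam i *: S`_i.

Definition in_dilate (S : seq 'rV[R]_N) (j : nat) (x : 'rV[R]_N) : Prop :=
  exists2 p, in_conv S p & x = j%:R *: p.

Definition lattice_count (S : seq 'rV[R]_N) (j c : nat) : Prop :=
  exists s : seq 'rV[int]_N,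
    [/\ uniq s, forall x : 'rV[int]_N, x \in s <-> in_dilate S j (map_mx intr x)
      & size s = c].

(* (dimension of conv(S)) + 1 : rank of the differences to the first point
   plus one; 0 for the empty polytope (dimension -1). *)
Definition dim_p1 (S : seq 'rV[R]_N) : nat :=
  if S is s0 :: _ then
    (\rank (\matrix_(i < size S, k < N) (S`_i - s0) 0 k)).+1
  else 0.

(* h is the h^*-polynomial of conv(S):
   sum_j L(j) z^j = h(z) / (1-z)^(d+1), written out coefficientwise as
   h = (1-z)^(d+1) * sum_j L(j) z^j. *)
Definition is_hstar (S : seq 'rV[R]_N) (h : {poly int}) : Prop :=
  exists L : nat -> nat,
    (forall j, lattice_count S j (L j)) /\
    forall k : nat,
      h`_k = \sum_(i < (dim_p1 S).+1 | (i <= k)%N)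
               (-1) ^+ i * ('C(dim_p1 S, i))%:Z * (L (k - i)%N)%:Z.
End Polytope.

Section Cosmo.
Variables (R : realType) (n m : nat) (ends : 'I_m -> 'I_n * 'I_n).

Definition ev (u : 'I_n) : 'rV[R]_(n + m) := delta_mx 0 (lshift m u).
Definition ee (f : 'I_m) : 'rV[R]_(n + m) := delta_mx 0 (rshift n f).

Definition e_tilde f := ev (ends f).1 + ev (ends f).2 - ee f.
Definition e_left  f := ev (ends f).1 - ev (ends f).2 + ee f.
Definition e_right f := - ev (ends f).1 + ev (ends f).2 + ee f.

Definition cosmo_points : seq 'rV[R]_(n + m) :=
  [seq ee f | f <- enum 'I_m] ++ [seq e_tilde f | f <- enum 'I_m] ++
  [seq e_left f | f <- enum 'I_m] ++ [seq e_right f | f <- enum 'I_m] ++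
  [seq ev u | u <- enum 'I_n].
End Cosmo.

Section Bridges.
Variables (n m : nat) (ends : 'I_m -> 'I_n * 'I_n).

Definition adjH (H : {set 'I_m}) : rel 'I_n :=
  fun u v => [exists e in H,
     (((ends e).1 == u) && ((ends e).2 == v)) ||
     (((ends e).1 == v) && ((ends e).2 == u))].

Definition is_bridge (H : {set 'I_m}) (e : 'I_m) : bool :=
  (e \in H) && ~~ connect (adjH (H :\ e)) (ends e).1 (ends e).2.

Definition bridgeless (H : {set 'I_m}) : bool :=
  [forall e, ~~ is_bridge H e].
End Bridges.

Definition mobius_from0 (m : nat) (P : pred {set 'I_m})
    (mu : {set 'I_m} -> int) : Prop :=
  mu set0 = 1 /\
  forall H, P H -> H != set0 ->
    \sum_(K : {set 'I_m} | P K && (K \subset H)) mu K = 0.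

(* Main.v *)
(* In the coordinates (a, b), where a absorbs the negative edge coordinates, the
   dual description of the cone over C_G says that (a, b) lies in it iff
   a(S) + b^+(delta S) >= 0 for every set S of vertices, and the dilation factor is
   sum a + sum |b|.  Moving one unit along an edge and using submodularity of this
   slack shows that lattice points are sums of generators, and that the lattice
   points over a point of G/e form an interval, which grows by 2 b_e when the
   capacity b_e is turned on.  Writing L for the Ehrhart series, this gives
   L(G) = (1 + z) / (1 - z) L(G - e) + 2 z / (1 - z)^2 L(G / e), so
   h^*(C_G; z) is the sum of (2z)^|F| (1 + z)^(m - |F|) over the forests F.
   By Moebius inversion the indicator of forests F is the sum of mu(H) over the
   bridgeless H contained in F, and expanding (1 + 3z) = (1 + z) + 2z finishes. *)
Require Import Defs.
From HB Require Import structures.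
From mathcomp Require Import all_boot all_order all_algebra.
From mathcomp Require Import reals.
From mathcomp Require Import zify ring.
Import Order.TTheory GRing.Theory Num.Theory.
Local Open Scope ring_scope.
Set Implicit Arguments. Unset Strict Implicit. Unset Printing Implicit Defensive.

(** * Power series acting on sequences *)

(** Coefficient of z^k in the product of p with the formal power series of L; an Ehrhart series is
    thus handled through its coefficients alone. *)
Definition series_act (p : {poly int}) (L : nat -> int) (k : nat) : int :=
  \sum_(i < k.+1) p`_i * L (k - i)%N.

(** Coefficients up to k only see a truncation of L, so associativity and the like reduce to
    polynomial products. *)
Lemma series_actE p L K k : (k < K)%N ->
  series_act p L k = (p * \poly_(i < K) L i)`_k.
Proof.
move=> kK; rewrite coefM; apply: eq_bigr => i _.
by rewrite coef_poly ifT //; lia.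
Qed.

Lemma eq_series_act p L M : L =1 M -> series_act p L =1 series_act p M.
Proof. by move=> LM k; apply: eq_bigr => i _; rewrite LM. Qed.

Lemma series_actM p q L k :
  series_act (p * q) L k = series_act p (series_act q L) k.
Proof.
rewrite (@series_actE _ _ k.+1) // -mulrA coefM; apply: eq_bigr => i _.
by rewrite -series_actE //; lia.
Qed.

Lemma series_act_coef p (h : {poly int}) k :
  series_act p (fun i => h`_i) k = (p * h)`_k.
Proof. by rewrite coefM. Qed.

Lemma series_actDl p q L k :
  series_act (p + q) L k = series_act p L k + series_act q L k.
Proof. by rewrite -big_split; apply: eq_bigr => i _; rewrite coefD mulrDl. Qed.

Lemma series_actNl p L k : series_act (- p) L k = - series_act p L k.
Proof. by rewrite -sumrN; apply: eq_bigr => i _; rewrite coefN mulNr. Qed.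

Lemma series_actDr p L M k :
  series_act p (fun i => L i + M i) k = series_act p L k + series_act p M k.
Proof. by rewrite -big_split; apply: eq_bigr => i _; rewrite mulrDr. Qed.

Lemma series_act1 L k : series_act 1 L k = L k.
Proof.
rewrite /series_act big_ord_recl coef1 mul1r subn0 big1 ?addr0 // => i _.
by rewrite coef1 mul0r.
Qed.

Definition shift (L : nat -> int) (k : nat) : int :=
  if k is k'.+1 then L k' else 0.

Lemma series_actX L k : series_act 'X L k = shift L k.
Proof.
case: k => [|k]; first by rewrite /series_act big_ord1 coefX mul0r.
rewrite /series_act big_ord_recl coefX mul0r add0r big_ord_recl coefX mul1r /=.
rewrite big1 => [|i _]; first by rewrite addr0 subSS subn0.
by rewrite coefX mul0r.
Qed.

Lemma series_act_diff L k : series_act (1 - 'X) L k = L k - shift L k.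
Proof. by rewrite series_actDl series_actNl series_act1 series_actX. Qed.

Lemma coef_exp_1subX D i :
  ((1 - 'X : {poly int}) ^+ D)`_i = (-1) ^+ i * ('C(D, i))%:Z.
Proof.
rewrite exprBn coef_sum.
transitivity (\sum_(j < D.+1) if (j == i :> nat) then (-1) ^+ i * ('C(D, i))%:Z else 0 : int).
  apply: eq_bigr => j _; rewrite coefMn expr1n mulr1.
  rewrite -[(-1) ^+ j]/((-1) ^+ j) -signr_odd.
  have -> : ((-1) ^+ odd j : {poly int}) = ((-1) ^+ odd j)%:P.
    by rewrite rmorphXn rmorphN rmorph1.
  rewrite coefCM coefXn eq_sym signr_odd.
  by case: eqP => [->|_]; rewrite ?mulr1 ?mulr0 ?mul0rn // pmulrn mulrzz.
case: (ltnP i D.+1) => iD.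
  rewrite (bigD1 (Ordinal iD)) //= eqxx big1 ?addr0 // => j.
  by rewrite -val_eqE /= => /negbTE ->.
rewrite big1 => [|j _]; first by rewrite bin_small ?mulr0.
by case: eqP => // ji; have := ltn_ord j; lia.
Qed.

(** Turns multiplication by (1 - z)^D into the finite sum that occurs in [is_hstar]. *)
Lemma series_act_exp_1subX D L k :
  series_act ((1 - 'X) ^+ D) L k =
  \sum_(i < D.+1 | (i <= k)%N) (-1) ^+ i * ('C(D, i))%:Z * L (k - i)%N.
Proof.
transitivity (\sum_(i < k.+1 | (i <= D)%N) (-1) ^+ i * ('C(D, i))%:Z * L (k - i)%N).
  rewrite [RHS]big_mkcond; apply: eq_bigr => i _; rewrite coef_exp_1subX.
  by case: leqP => // /bin_small ->; rewrite mulr0 mul0r.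
pose F i := (-1) ^+ i * ('C(D, i))%:Z * L (k - i)%N.
rewrite (big_ord_widen_cond (D + k).+1 (fun i => i <= D)%N F); last by lia.
rewrite (big_ord_widen_cond (D + k).+1 (fun i => i <= k)%N F); last by lia.
by apply: eq_bigl => i; rewrite !ltnS andbC.
Qed.

Lemma diff_sum (L M : nat -> int) :
  (forall j, M j = \sum_(i < j.+1) L (j - i)%N) -> series_act (1 - 'X) M =1 L.
Proof.
move=> ML k; rewrite series_act_diff ML /=.
case: k => [|k]; first by rewrite big_ord1 /= subr0.
rewrite big_ord_recl subn0 /= ML; under eq_bigr do rewrite /bump /= add1n subSS.
by rewrite addrK.
Qed.

(** In generating functions, M = (1 + z) / (1 - z) L: the deletion term of the recursion. *)
Lemma diff_two_sums (L M : nat -> int) :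
  (forall j, M j = \sum_(i < j.+1) L (j - i)%N + \sum_(i < j) L (j - i.+1)%N) ->
  series_act (1 - 'X) M =1 series_act (1 + 'X) L.
Proof.
move=> ML k; rewrite series_act_diff series_actDl series_act1 series_actX.
case: k => [|k] /=; first by rewrite ML big_ord1 big_ord0 /= addr0 subr0.
have step i : \sum_(l < i.+1) L (i - l)%N = L i + \sum_(l < i) L (i - l.+1)%N.
  by rewrite big_ord_recl subn0.
by rewrite !ML !step; ring.
Qed.

(** In generating functions, M = 2z / (1 - z)^2 L, as the weights 2(i + 1) are the coefficients of
    z^(i + 1) in that fraction: the contraction term. *)
Lemma diff2_weighted_sum (L M : nat -> int) :
  (forall j, M j = \sum_(i < j) (i.+1).*2%:Z * L (j - i.+1)%N) ->
  series_act ((1 - 'X) ^+ 2) M =1 series_act ('X *+ 2) L.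
Proof.
move=> ML k; rewrite expr2 series_actM.
have D1 j : series_act (1 - 'X) M j = 2 * \sum_(i < j) L (j - i.+1)%N.
  rewrite series_act_diff ML; case: j => [|j] /=; first by rewrite !big_ord0 subrr.
  rewrite ML big_ord_recl /= subn1 /= [X in _ = 2 * X]big_ord_recl /= subn1 mulrDr.
  rewrite -addrA; congr (_ + _).
  rewrite -sumrB mulr_sumr; apply: eq_bigr => i _; rewrite /bump /= add1n subSS.
  by rewrite -mulrBl; congr (_ * _); lia.
rewrite (eq_series_act _ D1) series_act_diff mulr2n series_actDl series_actX.
case: k => [|k] /=; first by rewrite big_ord0.
rewrite big_ord_recl /= subn1 /= mulrDr.
under [X in _ + _ * X - _]eq_bigr do rewrite /bump /= add1n subSS.
by rewrite addrK; ring.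
Qed.

(** * Slack of a vertex set *)

Definition pos_part (c : int) : int := if 0 <= c then c else 0.

Lemma pos_part_ge0 c : 0 <= pos_part c.
Proof. by rewrite /pos_part; case: ifP. Qed.

Section Slack.
Variables (n m : nat).
Implicit Types (ends : 'I_m -> 'I_n * 'I_n) (a : {ffun 'I_n -> int})
  (b : {ffun 'I_m -> int}) (S T A : {set 'I_n}) (s : seq 'I_m).

Definition separates ends f S := ((ends f).1 \in S) (+) ((ends f).2 \in S).

Definition slack ends a b S : int :=
  \sum_(x in S) a x + \sum_(f | separates ends f S) pos_part (b f).

(** The vertex part is modular, and a cut function with nonnegative capacities is submodular edge by
    edge. *)
Lemma slack_submod ends a b S T :
  slack ends a b (S :|: T) + slack ends a b (S :&: T) <=
  slack ends a b S + slack ends a b T.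
Proof.
rewrite /slack [leLHS]addrACA [leRHS]addrACA; apply: lerD.
  rewrite !(big_mkcond (fun x => x \in _)) -!big_split /=.
  apply: ler_sum => x _; rewrite inE in_setI.
  by case: (x \in S); case: (x \in T) => /=; lia.
rewrite !(big_mkcond (fun f => separates _ f _)) -!big_split /=.
apply: ler_sum => f _; rewrite /separates !inE.
move: (pos_part_ge0 (b f)).
by do 4![case: (_ \in _)] => /=; lia.
Qed.

Lemma slack_setT ends a b : slack ends a b setT = \sum_x a x.
Proof.
rewrite /slack [X in _ + X]big_pred0 ?addr0 => [|f].
  by apply: eq_bigl => x; rewrite inE.
by rewrite /separates !inE.
Qed.

(** * Moving along an edge and contracting it *)

Definition move_unit (u v : 'I_n) (t : int) a : {ffun 'I_n -> int} :=
  [ffun x => a x + t *+ (x == v) - t *+ (x == u)].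

Lemma sum_delta (I : finType) (P : pred I) (t : int) (v : I) :
  \sum_(x | P x) t *+ (x == v) = t *+ (P v).
Proof.
rewrite big_mkcond (bigD1 v) //= eqxx big1 ?addr0 => [|x /negbTE->].
  by case: (P v).
by rewrite mulr0n if_same.
Qed.

Lemma slack_move ends u v t a b S :
  slack ends (move_unit u v t a) b S =
  slack ends a b S + t *+ (v \in S) - t *+ (u \in S).
Proof.
rewrite /slack; under eq_bigr do rewrite ffunE.
by rewrite big_split sumrN big_split /= !sum_delta; ring.
Qed.

Lemma sum_move u v t a : \sum_x move_unit u v t a x = \sum_x a x.
Proof.
under eq_bigr do rewrite ffunE.
by rewrite big_split sumrN big_split /= !sum_delta addrK.
Qed.

Lemma move_unitK u v t t' a :
  move_unit u v t (move_unit u v t' a) = move_unit u v (t' + t) a.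
Proof. by apply/ffunP => x; rewrite !ffunE !mulrnDl; ring. Qed.

Lemma move_unit0 u v a : move_unit u v 0 a = a.
Proof. by apply/ffunP => x; rewrite !ffunE !mul0rn subr0 addr0. Qed.

(** The vertex type stays fixed: v is relabelled as u and left isolated, and the set A in [points]
    records which vertices are still active. *)
Definition contract (u v : 'I_n) ends (f : 'I_m) : 'I_n * 'I_n :=
  let c x := if x == v then u else x in (c (ends f).1, c (ends f).2).

Lemma slack_contract ends u v a b S : (u \in S) = (v \in S) ->
  slack (contract u v ends) a b S = slack ends a b S.
Proof.
move=> uv; congr (_ + _); apply: eq_bigl => f.
have in_c x : ((if x == v then u else x) \in S) = (x \in S).
  by case: eqP => // ->.
by rewrite /separates /= !in_c.
Qed.

(** After contraction v meets no edge and has weight 0, so it can be put on the side of u for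
    free. *)
Lemma slack_contract_setU ends u v a b S : u != v -> a v = 0 -> exists T,
  (u \in T) = (v \in T) /\
  slack (contract u v ends) a b S = slack (contract u v ends) a b T.
Proof.
move=> uv av; have vu : v != u by rewrite eq_sym.
exists (if u \in S then v |: S else S :\ v); split.
  by case: ifP => uS; rewrite !inE uS eqxx ?orbT ?andbF.
have notv x : (if x == v then u else x) == v = false.
  by case: ifP => // _; apply/negbTE.
have memT x : x != v -> (x \in if u \in S then v |: S else S :\ v) = (x \in S).
  by move=> /negbTE xv; case: ifP; rewrite !inE xv.
congr (_ + _).
  rewrite big_mkcond [RHS]big_mkcond; apply: eq_bigr => x _.
  have [->|xv] := eqVneq x v; first by rewrite av !if_same.
  by rewrite memT.
by apply: eq_bigl => f; rewrite /separates /= !memT ?notv.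
Qed.

(** How much can be moved from u to v before a set containing u but not v is violated; [[set u]]
    only witnesses that such sets exist. *)
Definition min_slack ends u v a b : int :=
  slack ends a b [arg min_(S < [set u] | (u \in S) && (v \notin S)) slack ends a b S]%O.

Lemma min_slackP ends u v a b (c : int) : u != v ->
  (forall S, u \in S -> v \notin S -> 0 <= slack ends a b S + c) <->
  0 <= min_slack ends u v a b + c.
Proof.
move=> uv; rewrite /min_slack; case: Order.TotalTheory.arg_minP => [|S /andP[uS vS] Smin].
  by rewrite !inE eqxx eq_sym.
split=> [|H T uT vT]; first exact.
by apply: le_trans H _; rewrite lerD2r; apply: Smin; rewrite uT.
Qed.

Lemma min_slackE ends u v a b : u != v -> exists S,
  [/\ u \in S, v \notin S & min_slack ends u v a b = slack ends a b S].
Proof.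
move=> uv; rewrite /min_slack; case: Order.TotalTheory.arg_minP => [|S /andP[uS vS] _].
  by rewrite !inE eqxx eq_sym.
by exists S.
Qed.

(* By submodularity a line of the contraction meets the points in a nonempty interval. *)
Lemma min_slack_opp ends u v a b : u != v ->
  (forall S, (u \in S) = (v \in S) -> 0 <= slack ends a b S) ->
  0 <= min_slack ends u v a b + min_slack ends v u a b.
Proof.
move=> uv H; have vu : v != u by rewrite eq_sym.
have [S [uS vS ->]] := min_slackE ends a b uv.
have [T [vT uT ->]] := min_slackE ends a b vu.
apply: le_trans (slack_submod ends a b S T); apply: addr_ge0; apply: H.
  by rewrite !inE uS vT orbT.
by rewrite !inE (negbTE vS) (negbTE uT) andbF.
Qed.

(** Lattice points of the j-th dilate in the coordinates (a, b), with vertices restricted to A and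
    edges to s. The term g holds the capacity of an edge outside s that is being turned on. *)
Definition points ends (g : {set 'I_n} -> int) A s (j : nat)
    (x : {ffun 'I_n -> int} * {ffun 'I_m -> int}) : bool :=
  [&& [forall y, (y \notin A) ==> (x.1 y == 0)],
      [forall f, (f \notin s) ==> (x.2 f == 0)],
      [forall S, 0 <= slack ends x.1 x.2 S + g S] &
      \sum_y x.1 y + \sum_f `|x.2 f| == j%:Z].

Definition widen ends e (w : int) S : int := w *+ separates ends e S.

Lemma points_contract ends u v A s j a b : u != v -> u \in A -> a v = 0 ->
  points (contract u v ends) (fun=> 0) (A :\ v) s j (a, b) =
  [&& [forall y, (y \notin A) ==> (a y == 0)],
      [forall f, (f \notin s) ==> (b f == 0)],
      [forall S : {set _}, ((u \in S) == (v \in S)) ==> (0 <= slack ends a b S)] &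
      \sum_y a y + \sum_f `|b f| == j%:Z].
Proof.
move=> uv uA av; congr [&& _, _, _ & _] => /=.
  apply: eq_forallb => y; rewrite !inE.
  by have [->|//] := eqVneq y v; rewrite /= av eqxx implybT.
apply/forallP/forallP => [H S|H S].
  apply/implyP => /eqP uS; rewrite -(slack_contract _ _ _ uS).
  by have := H S; rewrite addr0.
have [T [uT ->]] := slack_contract_setU ends b S uv av.
by rewrite addr0 slack_contract //; have := H T; rewrite uT eqxx.
Qed.

(** Sets not separating u from v do not see t and give the conditions of the contraction. Sets
    containing only u bound t from above, those containing only v from below, and capacity w on e
    relaxes both bounds by w. *)
Lemma points_move ends e u v A s j t w a b : ends e = (u, v) ->
  u != v -> u \in A -> v \in A -> a v = 0 ->
  points ends (widen ends e w) A s j (move_unit u v t a, b) =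
  [&& points (contract u v ends) (fun=> 0) (A :\ v) s j (a, b),
      - min_slack ends v u a b - w <= t & t <= min_slack ends u v a b + w].
Proof.
move=> Ee uv uA vA av; have vu : v != u by rewrite eq_sym.
have sepE S : separates ends e S = (u \in S) (+) (v \in S) by rewrite /separates Ee.
rewrite points_contract // /points /= sum_move.
have -> : [forall y, (y \notin A) ==> (move_unit u v t a y == 0)] =
          [forall y, (y \notin A) ==> (a y == 0)].
  apply: eq_forallb => y; rewrite ffunE.
  have [->|_] := eqVneq y v; first by rewrite vA.
  have [->|_] := eqVneq y u; first by rewrite uA.
  by rewrite !mulr0n subr0 addr0.
case: ([forall y, _]) => //=; case: ([forall f, _]) => //=.
rewrite andbC [in RHS](andbC _ (_ == _)) -andbA; congr (_ && _).
apply/forallP/and3P => [H|[/forallP H lo hi] S].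
  split.
  - apply/forallP => S; apply/implyP => /eqP uS; have := H S.
    rewrite slack_move /widen sepE uS addbb mulr0n addr0 addrK.
    exact.
  - suff: 0 <= min_slack ends v u a b + (t + w) by lia.
    apply/min_slackP => // S vS /negbTE uS; have := H S.
    by rewrite slack_move /widen sepE uS vS /= !mulr1n mulr0n; lia.
  - suff: 0 <= min_slack ends u v a b + (w - t) by lia.
    apply/min_slackP => // S uS /negbTE vS; have := H S.
    by rewrite slack_move /widen sepE uS vS /= !mulr1n mulr0n; lia.
rewrite slack_move /widen sepE.
have := H S; case uS: (u \in S); case vS: (v \in S) => //= HS; last 1 first.
- by rewrite !mulr0n; lia.
- by rewrite !mulr1n mulr0n; lia.
- have /min_slackP: 0 <= min_slack ends u v a b + (w - t) by lia.
  by move=> /(_ uv S uS (negbT vS)); rewrite !mulr1n mulr0n; lia.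
- have /min_slackP: 0 <= min_slack ends v u a b + (t + w) by lia.
  by move=> /(_ vu S vS (negbT uS)); rewrite !mulr1n mulr0n; lia.
Qed.

End Slack.

(** * Fibres of a contraction *)

Section Enum.
Variables (n m : nat).
Local Notation pt := ({ffun 'I_n -> int} * {ffun 'I_m -> int})%type.
Implicit Types (ends : 'I_m -> 'I_n * 'I_n) (a : {ffun 'I_n -> int})
  (b : {ffun 'I_m -> int}) (S T A : {set 'I_n}) (s : seq 'I_m).

(** The integer interval of [points_move]. The argument of [absz] is nonnegative by [min_slack_opp]
    whenever x is a point of the contraction. *)
Definition fibre_range ends u v (w : nat) (x : pt) : seq int :=
  [seq i%:Z - min_slack ends v u x.1 x.2 - w%:Z |
    i <- iota 0 (absz (min_slack ends u v x.1 x.2 + min_slack ends v u x.1 x.2 + 1 + w.*2%:Z)%R)].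

Definition fibres ends u v (w : nat) (E : seq pt) : seq pt :=
  [seq (move_unit u v t x.1, x.2) | x <- E, t <- fibre_range ends u v w x].

Lemma mem_fibre_range ends u v w x t :
  0 <= min_slack ends u v x.1 x.2 + min_slack ends v u x.1 x.2 ->
  (t \in fibre_range ends u v w x) =
  (- min_slack ends v u x.1 x.2 - w%:Z <= t <= min_slack ends u v x.1 x.2 + w%:Z).
Proof.
move=> H; apply/mapP/idP => [[i]|tr]; first by rewrite mem_iota; lia.
exists (absz (t + min_slack ends v u x.1 x.2 + w%:Z)); last by lia.
by rewrite mem_iota; lia.
Qed.

Lemma points_opp ends u v A s j (x : pt) : u != v -> u \in A ->
  points (contract u v ends) (fun=> 0) (A :\ v) s j x ->
  x.1 v = 0 /\ 0 <= min_slack ends u v x.1 x.2 + min_slack ends v u x.1 x.2.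
Proof.
case: x => a b uv uA P.
have av : a v = 0.
  by case/and4P: P => /forallP /(_ v); rewrite !inE eqxx => /eqP.
split=> //; apply: min_slack_opp => // S /eqP uS.
move: P; rewrite points_contract // => /and4P[_ _ /forallP/(_ S) + _].
by rewrite uS.
Qed.

Section Fibres.
Variables (ends : 'I_m -> 'I_n * 'I_n) (e : 'I_m) (A : {set 'I_n}) (s : seq 'I_m) (j : nat).
Variable E : seq pt.
Let u := (ends e).1.
Let v := (ends e).2.
Hypotheses (uv : u != v) (uA : u \in A) (vA : v \in A) (uniqE : uniq E).
Hypothesis memE : forall x, (x \in E) = points (contract u v ends) (fun=> 0) (A :\ v) s j x.

Lemma fibres_uniq w : uniq (fibres ends u v w E).
Proof.
clear vA.
apply: allpairs_uniq_dep => //.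
  move=> x _; rewrite map_inj_uniq ?iota_uniq // => i i'; lia.
move=> p q /allpairsPdep[x [t [xE _ ->]]] /allpairsPdep[x' [t' [x'E _ ->]]] /=.
move: xE x'E; rewrite !memE.
move=> /(points_opp uv uA)[xv _] /(points_opp uv uA)[xv' _] [eq1 eq2].
(* Both representatives vanish at v, so t is the coordinate of the moved point at v. *)
have tt' : t = t'.
  move/ffunP/(_ v): eq1; rewrite !ffunE xv xv' eqxx eq_sym (negbTE uv) /= !mulr0n.
  by rewrite !mulr1n; lia.
move: eq1; rewrite tt' => /(congr1 (move_unit u v (- t'))).
rewrite !move_unitK subrr !move_unit0 => eq1.
by case: x x' eq1 eq2 {xv xv'} => ? ? [? ?] /= -> ->.
Qed.

Lemma mem_fibres w x : (x \in fibres ends u v w E) = points ends (widen ends e w) A s j x.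
Proof.
have PM t a b (av : a v = 0) :=
  points_move s j t w b (surjective_pairing (ends e)) uv uA vA av.
apply/allpairsPdep/idP => [[x0 [t [x0E tr ->]]]|P].
  move: (x0E); rewrite memE => Px0; have [x0v lohi] := points_opp uv uA Px0.
  move: tr; rewrite mem_fibre_range // => tr.
  rewrite PM //.
  by rewrite -[(x0.1, x0.2)]surjective_pairing Px0.
case: x P => a b P.
(* Sliding back by the coordinate at v yields the representative of the line that vanishes at v. *)
pose a0 := move_unit u v (- a v) a.
have a0v : a0 v = 0.
  by rewrite ffunE eqxx [v == u]eq_sym (negbTE uv) mulr1n mulr0n subr0 subrr.
have aE : a = move_unit u v (a v) a0 by rewrite move_unitK addNr move_unit0.
move: P; rewrite {1}aE.
rewrite PM // => /andP[P tr].
exists (a0, b), (a v); rewrite memE; split=> //; last by rewrite /= -aE.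
by rewrite mem_fibre_range //; have [] := points_opp uv uA P.
Qed.

(** Capacity w lengthens each interval by w at both ends. *)
Lemma size_fibres w :
  size (fibres ends u v w E) = (size (fibres ends u v 0 E) + w.*2 * size E)%N.
Proof.
clear vA uniqE.
rewrite !size_allpairs_dep !sumnE !big_map -(sum1_size E) big_distrr -big_split.
apply: eq_big_seq => x; rewrite memE => /(points_opp uv uA)[_ H].
by rewrite !size_map !size_iota /=; lia.
Qed.

End Fibres.

(** * Turning on the coordinate of an edge *)

Definition add_edge (e : 'I_m) (c : int) (x : pt) : pt :=
  (x.1, [ffun f => x.2 f + c *+ (f == e)]).

(** A value c on e consumes |c| of the dilation factor and adds capacity only when positive. The
    guard |c| <= j is needed because the subtraction on [nat] truncates. *)
Lemma points_add_edge ends A s e c j a b : e \notin s -> b e = 0 ->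
  points ends (fun=> 0) A (e :: s) j (add_edge e c (a, b)) =
  (`|c| <= j)%N && points ends (widen ends e (pos_part c)) A s (j - `|c|)%N (a, b).
Proof.
move=> es be; rewrite /points /=.
case: ([forall y, _]); rewrite ?andbF //=.
have -> : [forall f, (f \notin e :: s) ==>
      ([ffun f0 => b f0 + c *+ (f0 == e)] f == 0)] =
    [forall f, (f \notin s) ==> (b f == 0)].
  apply: eq_forallb => f; rewrite ffunE inE.
  have [->|_] := eqVneq f e; first by rewrite be eqxx implybT.
  by rewrite mulr0n addr0.
case: ([forall f, _]); rewrite ?andbF //=.
have pos0 : pos_part 0 = 0 by [].
have slackE S : slack ends a [ffun f => b f + c *+ (f == e)] S =
    slack ends a b S + widen ends e (pos_part c) S.
  rewrite /slack -addrA; congr (_ + _); rewrite /widen.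
  rewrite -(sum_delta (fun f => separates ends f S)) -big_split /=.
  apply: eq_bigr => f _; rewrite ffunE; have [->|_] := eqVneq f e.
    by rewrite be !mulr1n pos0 !add0r.
  by rewrite !mulr0n !addr0.
have -> : [forall S, 0 <= slack ends a [ffun f => b f + c *+ (f == e)] S + 0] =
    [forall S, 0 <= slack ends a b S + widen ends e (pos_part c) S].
  by apply: eq_forallb => S; rewrite addr0 slackE.
case: forallP => [H|]; rewrite ?andbF //=.
(* The full vertex set is cut by no edge; its inequality makes the remaining degree nonnegative,
   which forces |c| <= j. *)
have sum_ge0 : 0 <= \sum_y a y.
  have := H setT; rewrite slack_setT /widen /separates !inE /= mulr0n addr0; exact.
have -> : \sum_f `|[ffun f0 => b f0 + c *+ (f0 == e)] f| = \sum_f `|b f| + `|c|.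
  rewrite -[X in _ + X]mulr1n -(sum_delta predT `|c| e) -big_split /=.
  apply: eq_bigr => f _; rewrite ffunE; have [->|_] := eqVneq f e.
    by rewrite be !mulr1n normr0 !add0r.
  by rewrite !mulr0n !addr0.
have : 0 <= \sum_f `|b f| by apply: sumr_ge0.
by move: (\sum_f _) (\sum_y _) sum_ge0; lia.
Qed.

(** Values c <= 0, which add no capacity, come first; the values c > 0 follow. This produces the two
    sums of [size_add_edges]. *)
Definition coords (j : nat) : seq int :=
  [seq - i%:Z | i <- iota 0 j.+1] ++ [seq i.+1%:Z | i <- iota 0 j].

Lemma mem_coords j c : (c \in coords j) = (`|c| <= j)%N.
Proof.
rewrite mem_cat; apply/orP/idP => [[]/mapP[i]|cj]; rewrite ?mem_iota; try lia.
have [c0|c0] := lerP c 0; [left|right]; apply/mapP.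
  by exists `|c|%N; rewrite ?mem_iota; lia.
by exists `|c|.-1%N; rewrite ?mem_iota; lia.
Qed.

Lemma coords_uniq j : uniq (coords j).
Proof.
rewrite cat_uniq !map_inj_uniq ?iota_uniq ?andbT /=; try by move=> x y; lia.
by apply/hasPn => c /mapP[i _ ->]; apply/mapP => -[k _]; lia.
Qed.

Definition add_edges e (E : nat -> nat -> seq pt) (j : nat) : seq pt :=
  [seq add_edge e c x | c <- coords j, x <- E `|pos_part c|%N (j - `|c|)%N].

Section AddEdges.
Variables (ends : 'I_m -> 'I_n * 'I_n) (e : 'I_m) (A : {set 'I_n}) (s : seq 'I_m).
Variable E : nat -> nat -> seq pt.
Hypotheses (es : e \notin s) (uniqE : forall w j, uniq (E w j)).
Hypothesis memE : forall w j x, (x \in E w j) = points ends (widen ends e w) A s j x.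

Lemma mem_E0 w j x : x \in E w j -> x.2 e = 0.
Proof. by rewrite memE => /and4P[_ /forallP/(_ e)]; rewrite es => /eqP. Qed.

Lemma add_edges_uniq j : uniq (add_edges e E j).
Proof.
apply: allpairs_uniq_dep => //; first exact: coords_uniq.
move=> p q /allpairsPdep[c [x [_ xE ->]]] /allpairsPdep[c' [x' [_ x'E ->]]] /=.
case=> eq1 /ffunP eq2.
have cc' : c = c'.
  by have := eq2 e; rewrite !ffunE eqxx !mulr1n (mem_E0 xE) (mem_E0 x'E) !add0r.
rewrite cc'; congr existT.
case: x x' eq1 eq2 {xE x'E} => a b [a' b'] /= -> eq2; congr pair.
by apply/ffunP => f; have := eq2 f; rewrite !ffunE cc' => /addIr.
Qed.

Lemma mem_add_edges j x :
  (x \in add_edges e E j) = points ends (fun=> 0) A (e :: s) j x.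
Proof.
have posE c : (`|pos_part c|%N : int) = pos_part c by rewrite /pos_part; case: ifP; lia.
apply/allpairsPdep/idP => [[c [[a b] [cj xE ->]]]|P].
  rewrite points_add_edge ?(mem_E0 xE) //.
  by rewrite -mem_coords cj; move: xE; rewrite memE posE.
case: x P => a b P; pose c := b e.
pose b0 : {ffun 'I_m -> int} := [ffun f => b f - c *+ (f == e)].
have b0e : b0 e = 0 by rewrite ffunE eqxx subrr.
have bE : (a, b) = add_edge e c (a, b0).
  by congr pair; apply/ffunP => f; rewrite !ffunE subrK.
exists c, (a, b0); rewrite mem_coords memE posE.
by move: P; rewrite bE points_add_edge // => /andP[].
Qed.

Lemma size_add_edges j : size (add_edges e E j) =
  (\sum_(i < j.+1) size (E 0 (j - i)) + \sum_(i < j) size (E i.+1 (j - i.+1)))%N.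
Proof.
clear es uniqE memE.
rewrite size_allpairs_dep map_cat sumn_cat -!map_comp !sumnE !big_map.
have iotaE k : iota 0 k = index_iota 0 k by rewrite /index_iota subn0.
rewrite !iotaE !big_mkord; congr (_ + _)%N; apply: eq_bigr => i _ //=.
have -> : pos_part (- i%:Z) = 0 by rewrite /pos_part; case: ifP; lia.
by rewrite abszN.
Qed.
End AddEdges.
End Enum.

(** * Ehrhart series by deletion and contraction *)

Section Count.
Variables (n m : nat).
Local Notation pt := ({ffun 'I_n -> int} * {ffun 'I_m -> int})%type.
Implicit Types (ends : 'I_m -> 'I_n * 'I_n) (a : {ffun 'I_n -> int})
  (b : {ffun 'I_m -> int}) (S T A : {set 'I_n}) (s : seq 'I_m).

(** * Base case: dilated standard simplices *)

Fixpoint simplex (l : seq 'I_n) (j : nat) : seq {ffun 'I_n -> int} :=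
  if l is y :: l' then
    [seq [ffun x => a x + i%:Z *+ (x == y)] | i <- iota 0 j.+1, a <- simplex l' (j - i)]
  else if j == 0 then [:: [ffun => 0]] else [::].

Lemma mem_simplex l j a : uniq l ->
  (a \in simplex l j) =
  [&& [forall y, (y \notin l) ==> (a y == 0)], [forall y, 0 <= a y]
    & \sum_y a y == j%:Z].
Proof.
elim: l j a => [|y l IH] j a.
  move=> _ /=; transitivity ((j == 0)%N && (a == [ffun => 0])).
    by case: (j == 0)%N; rewrite // inE.
  apply/andP/and3P => [[/eqP -> /eqP ->]|[/forallP a0 _ /eqP aj]].
    split; first by apply/forallP => y; rewrite ffunE.
      by apply/forallP => y; rewrite ffunE.
    by rewrite big1 // => y _; rewrite ffunE.
  have aE : a = [ffun => 0] by apply/ffunP => y; rewrite ffunE; apply/eqP; exact: a0.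
  split; last by rewrite aE.
  by move: aj; rewrite aE big1 => [/eqP|y _]; rewrite ?ffunE //; lia.
rewrite cons_uniq => /andP[yl ul].
have sumE a' c : \sum_x [ffun x => a' x + c *+ (x == y)] x = \sum_x a' x + c.
  under eq_bigr do rewrite ffunE.
  by rewrite big_split /= (sum_delta predT).
apply/allpairsPdep/and3P => [[i [a' []]]|[/forallP supp /forallP pos /eqP aj]].
  rewrite mem_iota IH // => ij /and3P[/forallP supp /forallP pos /eqP aj] ->; split.
  - apply/forallP => x; rewrite inE negb_or ffunE; apply/implyP => /andP[/negbTE -> xl].
    by rewrite addr0; have := supp x; rewrite xl.
  - by apply/forallP => x; rewrite ffunE addr_ge0 // mulrn_wge0.
  - by rewrite sumE aj; lia.
pose a' := [ffun x => a x + (- a y) *+ (x == y)].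
have a'y : a' y = 0 by rewrite ffunE eqxx subrr.
have a'x x : x != y -> a' x = a x by rewrite ffunE => /negbTE ->; rewrite addr0.
have sum_a' : \sum_x a' x = j%:Z - a y by rewrite sumE aj.
have a'pos x : 0 <= a' x.
  by have [->|xy] := eqVneq x y; [rewrite a'y|rewrite a'x].
have : 0 <= \sum_x a' x by apply: sumr_ge0.
rewrite sum_a' => ayj; have ay := pos y.
exists `|a y|%N, a'; rewrite mem_iota IH //; split; first by lia.
  apply/and3P; split.
  - apply/forallP => x; apply/implyP => xl; have [->|xy] := eqVneq x y; first by rewrite a'y.
    by rewrite a'x //; have := supp x; rewrite inE negb_or xy xl.
  - exact/forallP.
  - by rewrite sum_a'; lia.
apply/ffunP => x; rewrite ffunE; have [->|xy] := eqVneq x y.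
  by rewrite a'y mulr1n add0r gez0_abs.
by rewrite a'x // addr0.
Qed.

Lemma simplex_uniq l j : uniq l -> uniq (simplex l j).
Proof.
elim: l j => [|y l IH] j; first by move=> _ /=; case: ifP.
rewrite cons_uniq => /andP[yl ul]; apply: allpairs_uniq_dep; first exact: iota_uniq.
  by move=> i _; apply: IH.
move=> p q /allpairsPdep[i [x [_ xE ->]]] /allpairsPdep[i' [x' [_ x'E ->]]] /=.
move/ffunP => E.
have y0 k z : z \in simplex l k -> z y = 0.
  by rewrite mem_simplex // => /and3P[/forallP/(_ y)]; rewrite yl => /eqP.
have ii' : i = i'.
  by have := E y; rewrite !ffunE eqxx (y0 _ _ xE) (y0 _ _ x'E); lia.
rewrite ii'; congr existT; apply/ffunP => z; have := E z.
by rewrite !ffunE ii' => /addIr.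
Qed.

(** Each vertex contributes a factor 1 / (1 - z). *)
Lemma series_simplex l k :
  series_act ((1 - 'X) ^+ size l) (fun j => (size (simplex l j))%:Z) k = (k == 0)%:Z.
Proof.
elim: l k => [|y l IH] k; first by rewrite expr0 series_act1 /=; case: k.
rewrite -IH exprSr series_actM; apply: eq_series_act => i.
apply: (diff_sum (L := fun j => (size (simplex l j))%:Z)) => j.
rewrite size_allpairs_dep sumnE big_map.
have iotaE r : iota 0 r = index_iota 0 r by rewrite /index_iota subn0.
by rewrite iotaE big_mkord (big_morph Posz PoszD (erefl _)).
Qed.

(** Without edges the slack of S is a(S), and singletons already force a >= 0. *)
Lemma points_nil ends A j x :
  points ends (fun=> 0) A [::] j x =
  (x.2 == [ffun => 0]) && (x.1 \in simplex (enum A) j).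
Proof.
case: x => a b; rewrite mem_simplex ?enum_uniq // /points /=.
have -> : [forall f, (f \notin [::]) ==> (b f == 0)] = (b == [ffun => 0]).
  apply/forallP/eqP => [H|-> f]; last by rewrite ffunE.
  by apply/ffunP => f; rewrite ffunE; apply/eqP; apply: H.
have -> : [forall y, (y \notin enum A) ==> (a y == 0)] =
          [forall y, (y \notin A) ==> (a y == 0)].
  by apply: eq_forallb => y; rewrite mem_enum.
rewrite andbCA; case: eqP => //= ->; congr [&& _, _ & _].
  have slackE S : slack ends a [ffun => 0] S = \sum_(x in S) a x.
    rewrite /slack [X in _ + X]big1 ?addr0 // => f _.
    by rewrite ffunE.
  apply/forallP/forallP => [H y|H S].
    by have := H [set y]; rewrite slackE big_set1 addr0.
  by rewrite slackE addr0; apply: sumr_ge0.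
by rewrite [X in _ + X]big1 ?addr0 // => f _; rewrite ffunE normr0.
Qed.

(** Deletion and contraction; a loop separates no vertex set, hence has no contraction term. *)
Fixpoint hstar_rec ends (s : seq 'I_m) : {poly int} :=
  if s is e :: s' then
    (1 + 'X) * hstar_rec ends s' +
    (if (ends e).1 == (ends e).2 then 0
     else 'X *+ 2 * hstar_rec (contract (ends e).1 (ends e).2 ends) s')
  else 1.

(** The induction on s keeps [ends] and A general, since contraction changes both. The exponent is
    the number of active coordinates. *)
Lemma points_enum s ends A : uniq s ->
  (forall f, ((ends f).1 \in A) && ((ends f).2 \in A)) ->
  exists E : nat -> seq pt,
    [/\ forall j, uniq (E j),
        forall j x, (x \in E j) = points ends (fun=> 0) A s j x
      & forall k, series_act ((1 - 'X) ^+ (#|A| + size s))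
          (fun j => (size (E j))%:Z) k = (hstar_rec ends s)`_k].
Proof.
elim: s ends A => [|e s IH] ends A.
  move=> _ _; exists (fun j => [seq (a, [ffun => 0]) | a <- simplex (enum A) j]).
  split=> [j|j x|k].
  - by rewrite map_inj_uniq ?simplex_uniq ?enum_uniq // => x y [].
  - rewrite points_nil; apply/mapP/andP => [[a aE ->]|[/eqP b0 aE]] //=.
    by exists x.1 => //; rewrite -b0 -surjective_pairing.
  - rewrite /= coef1 natz addn0 cardE -(series_simplex (enum A)).
    by apply: eq_series_act => j; rewrite size_map.
rewrite cons_uniq => /andP[es us] endsA.
have [ED [uED mED hED]] := IH ends A us endsA.
have /andP[uA vA] := endsA e.
set u := (ends e).1 in uA *; set v := (ends e).2 in vA *.
have expE c : ((1 - 'X : {poly int}) ^+ (c + size (e :: s))) =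
    (1 - 'X) ^+ (c + size s) * (1 - 'X) by rewrite addnS exprSr.
have [uv|uv] := eqVneq u v.
  (* Capacity on a loop is invisible, so every value of the new coordinate sees a copy of the
     deletion. *)
  have memE w j x : (x \in ED j) = points ends (widen ends e w) A s j x.
    rewrite mED; congr [&& _, _, _ & _]; apply: eq_forallb => S.
    by rewrite /widen /separates -/u -/v uv addbb.
  exists (add_edges e (fun=> ED)); split=> [j|j x|k].
  - exact: add_edges_uniq memE j.
  - exact: mem_add_edges memE j x.
  rewrite expE series_actM /= -/u -/v uv eqxx addr0.
  rewrite (eq_series_act _ (diff_two_sums (L := fun j => (size (ED j))%:Z) _)).
    rewrite -series_actM mulrC series_actM (eq_series_act _ hED).
    exact: series_act_coef.
  move=> j; rewrite (size_add_edges e (fun=> ED)) PoszD.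
  by rewrite !(big_morph Posz PoszD (erefl _)).
have endsC f : ((contract u v ends f).1 \in A :\ v) && ((contract u v ends f).2 \in A :\ v).
  have inC x : x \in A -> (if x == v then u else x) \in A :\ v.
    by move=> xA; case: ifP => xv; rewrite !inE ?uv ?uA ?xA ?xv.
  by have /andP[? ?] := endsA f; rewrite /contract /= !inC.
have [EC [uEC mEC hEC]] := IH (contract u v ends) (A :\ v) us endsC.
pose E w j := fibres ends u v w (EC j).
have uE w j : uniq (E w j) by apply: (fibres_uniq (ends := ends) (e := e) uv uA (uEC j) (mEC j)).
have mE w j x : (x \in E w j) = points ends (widen ends e w) A s j x.
  exact: (mem_fibres (ends := ends) (e := e) uv uA vA (mEC j)).
(* Fibres of width 0 enumerate the points of the deletion; width w adds 2w points over each point of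
   the contraction. *)
have szE w j : size (E w j) = (size (ED j) + w.*2 * size (EC j))%N.
  rewrite /E (size_fibres (ends := ends) (e := e) uv uA (mEC j)); congr (_ + _)%N.
  apply: perm_size; apply: uniq_perm; [exact: uE|exact: uED|] => x.
  rewrite (mE 0) mED; congr [&& _, _, _ & _]; apply: eq_forallb => S.
  by rewrite /widen mul0rn.
exists (add_edges e E); split=> [j|j x|k].
- exact: add_edges_uniq mE j.
- exact: mem_add_edges mE j x.
(* L1 collects a copy of the deletion for every value of the new coordinate, L2 the surplus from the
   positive values c = i + 1. *)
pose L1 j := \sum_(i < j.+1) (size (ED (j - i)%N))%:Z + \sum_(i < j) (size (ED (j - i.+1)%N))%:Z.
pose L2 j := \sum_(i < j) (i.+1).*2%:Z * (size (EC (j - i.+1)%N))%:Z.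
have LE j : (size (add_edges e E j))%:Z = L1 j + L2 j.
  rewrite (size_add_edges e E) PoszD !(big_morph Posz PoszD (erefl _)) /L1 -addrA.
  congr (_ + _); first by apply: eq_bigr => i _; rewrite szE mul0n addn0.
  by rewrite -big_split; apply: eq_bigr => i _; rewrite szE PoszD PoszM.
rewrite (eq_series_act _ LE) series_actDr /= (negbTE uv) coefD; congr (_ + _).
  rewrite expE series_actM (eq_series_act _ (diff_two_sums (L := fun j => (size (ED j))%:Z) _)) //.
  rewrite -series_actM mulrC series_actM (eq_series_act _ hED).
  exact: series_act_coef.
(* The contraction has one vertex and one edge fewer, which leaves (1 - z)^2 to cancel the
   denominator of its term. *)
have -> : (#|A| + (size s).+1 = #|A :\ v| + size s + 2)%N.
  by rewrite (cardsD1 v A) vA add1n !addnS addn0 addSn.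
rewrite exprD series_actM.
rewrite (eq_series_act _ (diff2_weighted_sum (L := fun j => (size (EC j))%:Z) _)) //.
rewrite -series_actM mulrC series_actM (eq_series_act _ hEC).
exact: series_act_coef.
Qed.

End Count.

(** * Forests and the Moebius function *)

Section Forests.
Variables (n m : nat) (ends : 'I_m -> 'I_n * 'I_n).
Implicit Types (H K F C : {set 'I_m}) (e f : 'I_m).
Local Notation conn H := (connect (adjH ends H)).

Lemma adjH_sym H : symmetric (adjH ends H).
Proof.
by move=> x y; apply: eq_existsb => e; rewrite [X in _ && X]orbC.
Qed.

Lemma conn_sym H x y : conn H x y = conn H y x.
Proof. exact: (sym_connect_sym (adjH_sym H)). Qed.

Lemma conn_edge H e : e \in H -> conn H (ends e).1 (ends e).2.
Proof. by move=> eH; apply/connect1/existsP; exists e; rewrite eH !eqxx. Qed.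

Lemma conn_mono H K x y : H \subset K -> conn H x y -> conn K x y.
Proof.
move=> HK; apply: connect_sub => {}x {}y /existsP[e /andP[eH exy]].
by apply/connect1/existsP; exists e; rewrite (subsetP HK).
Qed.

(** A walk can be shortened to cross e at most once; the direction of the crossing gives the last
    two cases. *)
Lemma conn_setU1 H e x y : conn (e |: H) x y ->
  [|| conn H x y, conn H x (ends e).1 && conn H (ends e).2 y
    | conn H x (ends e).2 && conn H (ends e).1 y].
Proof.
case/connectP => p; elim: p x => [x _ -> |z p IH x /= /andP[xz zp] yE].
  by rewrite connect0.
have {IH} := IH z zp yE; case/existsP: xz => f; rewrite !inE.
case/andP=> /orP[/eqP ->|fH] fxz; last first.
  have xz : conn H x z by apply/connect1/existsP; exists f; rewrite fH.
  by case/or3P=> [zy|/andP[z1 ->]|/andP[z2 ->]];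
    rewrite ?(connect_trans xz zy) ?(connect_trans xz z1) ?(connect_trans xz z2) ?orbT.
case/orP: fxz => /andP[/eqP E1 /eqP E2]; rewrite E1 E2 !connect0 /=.
  by case/or3P=> [->|/andP[_ ->]|->]; rewrite ?orbT.
by case/or3P=> [->|->|/andP[_ ->]]; rewrite ?orbT.
Qed.

(** Acyclicity, phrased through bridgeless subsets so that Möbius inversion applies directly. *)
Definition forest F :=
  [forall H : {set 'I_m}, (H \subset F) && bridgeless ends H ==> (H == set0)].

Lemma bridgelessP H : reflect
  (forall e, e \in H -> conn (H :\ e) (ends e).1 (ends e).2) (bridgeless ends H).
Proof.
apply: (iffP forallP) => bl e; last by rewrite negb_and negbK; case: (boolP (e \in H)) => // /bl ->.
by move=> eH; have := bl e; rewrite /is_bridge eH negbK.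
Qed.

Lemma bridgeless_bigcup (P : pred {set 'I_m}) :
  (forall H, P H -> bridgeless ends H) -> bridgeless ends (\bigcup_(H | P H) H).
Proof.
move=> blP; apply/bridgelessP => e /bigcupP[H PH eH].
by apply: conn_mono (bridgelessP _ (blP H PH) e eH); apply/setSD/bigcup_sup.
Qed.

Lemma sum_mobius (mu : {set 'I_m} -> int) K : mobius_from0 (bridgeless ends) mu ->
  \sum_(H : {set 'I_m} | bridgeless ends H && (H \subset K)) mu H = (forest K)%:Z.
Proof.
case=> mu0 muP; have [/forallP fK|] := boolP (forest K).
  rewrite (big_pred1 set0) ?mu0 // => H; apply/idP/eqP => [|->].
    by have := fK H; rewrite andbC => /implyP + ? => /(_ _)/eqP; apply.
  by rewrite sub0set andbT; apply/bridgelessP => e; rewrite inE.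
rewrite negb_forall => /existsP[H]; rewrite negb_imply => /andP[/andP[HK blH] H0].
pose P (H : {set 'I_m}) := bridgeless ends H && (H \subset K).
(* Bridgeless sets are closed under union, so M is the largest one inside K. Those below K are
   exactly those below M, and M is nonempty, so the Möbius sum vanishes. *)
pose M := \bigcup_(H | P H) H.
rewrite -[RHS](muP M).
- apply: eq_bigl => J; case blJ: (bridgeless ends J) => //=.
  apply/idP/idP => [JK|/subset_trans]; first by apply: bigcup_sup; rewrite /P blJ.
  by apply; apply/bigcupsP => L /andP[].
- by apply: bridgeless_bigcup => J /andP[].
- apply: contraNneq H0 => M0; rewrite -subset0 -M0; apply: bigcup_sup.
  by rewrite /P blH.
Qed.

(** A bridgeless subset containing e would join the ends of e through its other edges, all of which
    lie in C. *)
Lemma forest_setU1 C e : forest C -> ~~ conn C (ends e).1 (ends e).2 ->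
  forest (e |: C).
Proof.
move=> fC nconn; apply/forallP => H; apply/implyP => /andP[HeC blH].
case eH: (e \in H).
  case/negP: nconn; apply: conn_mono (bridgelessP _ blH e eH).
  by rewrite subDset setUC; rewrite setUC in HeC.
apply: implyP (forallP fC H) _; rewrite blH andbT.
apply/subsetP => f fH; have := subsetP HeC f fH.
by rewrite !inE => /orP[/eqP fe|//]; rewrite -fe fH in eH.
Qed.

Lemma not_forest C F e : e \notin C -> conn C (ends e).1 (ends e).2 ->
  e |: C \subset F -> ~~ forest F.
Proof.
move=> eC connC eCF.
pose P (H : {set 'I_m}) := conn H (ends e).1 (ends e).2.
(* A minimal connecting subset H is a path between the ends of e, so that e and H together form a
   cycle. *)
have [H minH HC] := minset_exists (P := P) connC.
have PH : P H by case/minsetP: minH.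
have eH : e \notin H by apply: contra eC; apply: subsetP.
apply/negP => /forallP /(_ (e |: H)) /implyP.
have -> : (e |: H \subset F) && bridgeless ends (e |: H).
  rewrite (subset_trans _ eCF) ?setUS //=; apply/bridgelessP => g.
  rewrite !inE; have [->|ge] := eqVneq g e => /= [_|gH]; first by rewrite setU1K.
  have Hg : H = g |: H :\ g by rewrite setD1K.
  have sub : H :\ g \subset (e |: H) :\ g by rewrite setSD // subsetUr.
  have ee : conn ((e |: H) :\ g) (ends e).1 (ends e).2.
    by apply: conn_edge; rewrite !inE eqxx eq_sym ge.
  (* A connection avoiding g contradicts minimality; otherwise the two pieces on either side of g,
     joined by e, link the ends of g. *)
  move: PH; rewrite /P {1}Hg => /conn_setU1/or3P[PHg|/andP[a b]|/andP[a b]].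
  - case/minsetP: minH => _ /(_ _ PHg (subsetDl _ _)) /setP/(_ g).
    by rewrite !inE eqxx gH.
  - move: (conn_mono sub a) (conn_mono sub b); rewrite conn_sym => a' b'.
    by rewrite (connect_trans a') // (connect_trans ee) // conn_sym.
  - move: (conn_mono sub a) (conn_mono sub b) => a' b'.
    rewrite (connect_trans b') //; rewrite conn_sym in ee.
    by rewrite (connect_trans ee).
by move=> /(_ isT) /eqP /setP /(_ e); rewrite !inE eqxx.
Qed.

(** Invariant of the recursion: C is the set of edges contracted so far, d the number deleted, s
    those pending, and r sends a vertex to the representative of its component in C. *)
Lemma forest_sum s C (r : 'I_n -> 'I_n) (ends' : 'I_m -> 'I_n * 'I_n) (d : nat) :
  uniq s -> (forall e, e \in C -> e \notin s) -> forest C ->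
  (forall x y, (r x == r y) = conn C x y) ->
  (forall f, ends' f = (r (ends f).1, r (ends f).2)) ->
  (#|C| + size s + d = m)%N ->
  \sum_(F : {set 'I_m} | [&& C \subset F, F \subset C :|: [set x in s] & forest F])
     ('X *+ 2) ^+ #|F| * (1 + 'X) ^+ (m - #|F|) =
  ('X *+ 2) ^+ #|C| * (1 + 'X) ^+ d * hstar_rec ends' s.
Proof.
elim: s C r ends' d => [|e s IH] C r ends' d.
  move=> _ _ fC _ _ /=; rewrite addn0 mulr1 => dE; rewrite (big_pred1 C) => [|F].
    by congr (_ * _ ^+ _); rewrite -{1}dE addKn.
  have -> : [set x in [::]] = set0 :> {set 'I_m} by apply/setP => x; rewrite !inE.
  rewrite setU0 andbA -eqEsubset eq_sym.
  by apply: andb_idr => /eqP ->.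
rewrite cons_uniq => /andP[es us] Cs fC rE endsE /= dE.
have eC : e \notin C by apply/negP => /Cs; rewrite inE eqxx.
rewrite (bigID (fun F : {set 'I_m} => e \notin F)) /= mulrDr; congr (_ + _).
  rewrite (mulrCA _ (1 + 'X)) mulrA -[(1 + 'X) * _]mulrCA -exprS.
  rewrite -(IH C r ends' d.+1) //; last by move: dE; rewrite !addnS addSn.
    apply: eq_bigl => F; rewrite andbC !andbA [_ && (C \subset F)]andbC -!andbA.
    congr (_ && _); rewrite andbA; congr (_ && _); apply/andP/subsetP => [[eF /subsetP FC] f fF|FC].
      by have := FC f fF; rewrite !inE; have [fe|//] := eqVneq f e; rewrite -fe fF in eF.
    split; first by apply/negP => /FC; rewrite !inE (negbTE es) (negbTE eC).
    by apply/subsetP => f /FC; rewrite !inE => /orP[->|->] //; rewrite !orbT.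
  by move=> f /Cs; rewrite inE negb_or => /andP[].
(* If C already connects the ends of e, then e has become a loop, and no forest containing C
   contains e. *)
rewrite !endsE /= rE; case: ifP => conne.
  rewrite mulr0 big_pred0 // => F; rewrite negbK; apply/negP => /andP[/and3P[CF _ fF] eF].
  by move: fF; apply/negP/(not_forest eC conne); rewrite subUset sub1set eF.
have eCS : #|e |: C| = #|C|.+1 by rewrite cardsU1 eC.
rewrite mulrACA -exprSr -eCS mulrA.
(* The new representative map merges two components just as [contract] merges two vertices. *)
rewrite -(IH (e |: C) (fun x => if r x == r (ends e).2 then r (ends e).1 else r x)) //.
- apply: eq_bigl => F; rewrite negbK subUset sub1set.
  have -> : e |: C :|: [set x in s] = C :|: [set x in e :: s].
    by apply/setP => x; rewrite !inE; case: (x == e); rewrite ?orbT.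
  by case: (e \in F); rewrite ?andbF ?andbT.
- move=> f; rewrite !inE => /orP[/eqP -> //|/Cs].
  by rewrite inE negb_or => /andP[].
- by apply: forest_setU1; rewrite ?conne.
- move=> x y; have cU : C \subset e |: C by rewrite subsetUr.
  have ee : conn (e |: C) (ends e).1 (ends e).2 by apply: conn_edge; rewrite !inE eqxx.
  apply/idP/idP => [|/conn_setU1].
    case: ifP => xe; case: ifP => ye.
    + move=> _; apply: (conn_mono cU); rewrite -rE.
      by rewrite (eqP xe) (eqP ye).
    + rewrite !rE in xe ye * => ey; apply: connect_trans (conn_mono cU xe) _.
      by rewrite conn_sym in ee; apply: connect_trans ee (conn_mono cU ey).
    + rewrite !rE in xe ye * => xe1; apply: connect_trans (conn_mono cU xe1) _.
      by apply: connect_trans ee _; rewrite conn_sym (conn_mono cU ye).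
    + by rewrite rE => /(conn_mono cU).
  rewrite -!rE => /or3P[/eqP -> //|/andP[/eqP -> /eqP <-]|/andP[/eqP -> /eqP <-]].
    by rewrite eqxx if_same.
  by rewrite eqxx if_same.
- by move=> f; rewrite /contract !endsE.
- by rewrite eCS addSnnS.
Qed.

(** Expand the product over all edges: an edge of H can only choose p, any other chooses p or q. *)
Lemma expr_subset_sum H (p q : {poly int}) :
  p ^+ #|H| * (q + p) ^+ (m - #|H|) =
  \sum_(K : {set 'I_m} | H \subset K) p ^+ #|K| * q ^+ (m - #|K|).
Proof.
have cardC K : (m - #|K| = #|~: K|)%N by have := cardsC K; rewrite card_ord; lia.
have prodK K (x y : {poly int}) :
    \prod_(i : 'I_m) (if i \in K then x else y) = x ^+ #|K| * y ^+ (m - #|K|).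
  rewrite (bigID (mem K)) /= cardC -!prodr_const; congr (_ * _).
    by apply: eq_bigr => i ->.
  by apply: eq_big => i; [rewrite inE|move/negbTE ->].
rewrite -prodK; transitivity (\prod_(i : 'I_m) (p + (if i \in H then 0 else q))).
  by apply: eq_bigr => i _; case: ifP => _; rewrite ?addr0 // addrC.
rewrite bigA_distr [RHS]big_mkcond; apply: eq_bigr => K _; case: ifP => HK.
  rewrite -prodK; apply: eq_bigr => i _; case: ifP => // iK.
  by case: ifP => // /(subsetP HK); rewrite iK.
have /subsetPn[i iH iK] := negbT HK.
by rewrite (bigD1 i) //= (negbTE iK) iH mul0r.
Qed.

Lemma mobius_hstar (mu : {set 'I_m} -> int) : mobius_from0 (bridgeless ends) mu ->
  \sum_(H : {set 'I_m} | bridgeless ends H)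
    mu H *: (('X *+ 2) ^+ #|H| * (1 + 'X *+ 3) ^+ (m - #|H|)) =
  hstar_rec ends (enum 'I_m).
Proof.
move=> mob.
have := @forest_sum (enum 'I_m) set0 id ends 0 (enum_uniq _).
rewrite cards0 expr0 !mul1r => <-; first last.
- by rewrite size_enum_ord !addn0.
- by move=> f; rewrite -surjective_pairing.
- move=> x y; apply/eqP/connectP => [->|[[|z p] /= + ->]]; first by exists [::].
    by [].
  by case/andP => /existsP[e]; rewrite inE.
- by apply/forallP => H; rewrite subset0; apply/implyP => /andP[].
- by move=> e; rewrite inE.
transitivity (\sum_(K : {set 'I_m}) (forest K)%:Z *:
    (('X *+ 2) ^+ #|K| * (1 + 'X) ^+ (m - #|K|)) : {poly int}).
  under [RHS]eq_bigr do rewrite -(sum_mobius _ mob) scaler_suml.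
  rewrite (exchange_big_dep (bridgeless ends)) /= => [|K H _ /andP[] //].
  (* Here 1 + 3z is split as (1 + z) + 2z. *)
  apply: eq_bigr => H blH; rewrite mulrS addrA expr_subset_sum scaler_sumr.
  by apply: eq_bigl => K; rewrite blH.
rewrite [RHS]big_mkcond; apply: eq_bigr => K _; rewrite sub0set set0U /=.
have -> : K \subset [set x in enum 'I_m].
  by apply/subsetP => e _; rewrite inE mem_enum.
by case: (forest K); rewrite /= ?scale1r ?scale0r.
Qed.

End Forests.

(** * Geometry of the cosmological polytope *)

Section Dimension.
Variables (R : realType) (N : nat).

(** The differences are killed by the nonzero W, so their rank is at most N - 1; together with one
    point they span the whole space, so it is at least N - 1. *)
Lemma dim_p1_full (S : seq 'rV[R]_N) (W : 'cV[R]_N) : (0 < N)%N ->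
  (forall k, delta_mx 0 k \in S) -> (forall g, g \in S -> g *m W = 1%:M) ->
  dim_p1 S = N.
Proof.
move=> N0 deltaS SW; case: S => [|s0 S'] in deltaS SW *.
  by have := deltaS (Ordinal N0).
set S := s0 :: S' in deltaS SW *.
pose M := \matrix_(i < size S, k < N) (S`_i - s0) 0 k.
rewrite -[dim_p1 S]/(\rank M).+1.
have rowM i : row i M = S`_i - s0 by apply/rowP => k; rewrite !mxE.
have MW : M *m W = 0.
  apply/row_matrixP => i; rewrite row_mul rowM row0 mulmxBl !SW ?subrr //.
    by rewrite inE eqxx.
  exact: mem_nth.
have W0 : (0 < \rank W)%N.
  rewrite lt0n mxrank_eq0; apply/eqP => W0.
  have := SW s0 (mem_head _ _); rewrite W0 mulmx0 => /esym/eqP.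
  by rewrite -mxrank_eq0 mxrank1.
have up := mulmx0_rank_max MW.
have low : (1%:M <= M + s0)%MS.
  apply/row_subP => k; rewrite row1; have /(nthP 0)[i iS <-] := deltaS k.
  rewrite -(subrK s0 S`_i); apply: addmx_sub_adds => //.
  by rewrite -(rowM (Ordinal iS)) row_sub.
have := mxrankS low; rewrite mxrank1.
have := (mxrank_adds_leqif M s0).1; have := rank_leq_row s0.
by move: up W0; set a := \rank M; set b := \rank W; set c := \rank s0; set d := \rank (M + s0); lia.
Qed.
End Dimension.

(** * The cone over the polytope and integer decomposition *)

Definition neg_part (c : int) : int := pos_part (- c).

Section Cone.
Variables (R : realType) (n m : nat) (ends : 'I_m -> 'I_n * 'I_n).
Local Notation pt := ({ffun 'I_n -> int} * {ffun 'I_m -> int})%type.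
Implicit Types (a : {ffun 'I_n -> int}) (b : {ffun 'I_m -> int}) (x : pt).

(** The coordinate sum of [to_vec x]: a negative b_f contributes b_f + 2 |b_f| = |b_f|. *)
Definition degree x : int := \sum_y x.1 y + \sum_f `|x.2 f|.

Lemma points_setT j x :
  points ends (fun=> 0) setT (enum 'I_m) j x =
  [forall S, 0 <= slack ends x.1 x.2 S] && (degree x == j%:Z).
Proof.
rewrite /points; have -> /= : [forall y, (y \notin setT) ==> (x.1 y == 0)].
  by apply/forallP => y; rewrite inE.
have -> /= : [forall f, (f \notin enum 'I_m) ==> (x.2 f == 0)].
  by apply/forallP => f; rewrite mem_enum.
by congr (_ && _); apply: eq_forallb => S; rewrite addr0.
Qed.

Local Notation ev := (ev R m).
Local Notation ee := (@ee R n m).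

(** This is c copies of [ee f] for c >= 0, and |c| copies of [e_tilde f] for c < 0. *)
Definition edge_vec (f : 'I_m) (c : int) : 'rV[R]_(n + m) :=
  c%:~R *: ee f + (neg_part c)%:~R *: (ev (ends f).1 + ev (ends f).2).

(* Inverse of the coordinate change in which the negative part of the edge
   coordinates is absorbed by the vertex coordinates. *)
Definition to_vec x : 'rV[R]_(n + m) :=
  \sum_y (x.1 y)%:~R *: ev y + \sum_f edge_vec f (x.2 f).

Lemma edge_vecD f c t : edge_vec f (c + t) =
  edge_vec f c + t%:~R *: ee f
  + (neg_part (c + t) - neg_part c)%:~R *: (ev (ends f).1 + ev (ends f).2).
Proof.
rewrite /edge_vec rmorphD rmorphB scalerDl scalerBl.
have swap (x y z w : 'rV[R]_(n + m)) : x + y + z = x + w + y + (z - w).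
  by rewrite (addrAC x w) -(addrA (x + y)) (addrCA w) subrr addr0.
exact: swap.
Qed.

Lemma to_vec_add_edge f t x : to_vec (add_edge f t x) =
  to_vec x + t%:~R *: ee f
  + (neg_part (x.2 f + t) - neg_part (x.2 f))%:~R *: (ev (ends f).1 + ev (ends f).2).
Proof.
have swap (p c y z s : 'rV[R]_(n + m)) : p + (c + y + z + s) = p + (c + s) + y + z.
  by rewrite -!addrA; congr (_ + (_ + _)); rewrite addrA addrC.
rewrite /to_vec /= (bigD1 f) //= [in RHS](bigD1 f) //= ffunE eqxx mulr1n edge_vecD.
rewrite -swap; congr (_ + (_ + _)).
by apply: eq_bigr => g /negbTE gf; rewrite ffunE gf addr0.
Qed.

Lemma to_vec_vertex (a a' : {ffun 'I_n -> int}) b :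
  to_vec (a, b) = to_vec (a', b) + \sum_y (a y - a' y)%:~R *: ev y.
Proof.
rewrite /to_vec /= addrAC -big_split /=; congr (_ + _); apply: eq_bigr => y _.
by rewrite -scalerDl -rmorphD addrC subrK.
Qed.

Lemma sum_delta_vec (t : int) (v : 'I_n) : \sum_y (t *+ (y == v))%:~R *: ev y = t%:~R *: ev v.
Proof.
rewrite (bigD1 v) //= eqxx big1 ?addr0 // => y /negbTE ->.
by rewrite mulr0n scale0r.
Qed.

Lemma to_vec_move u v a b :
  to_vec (a, b) = to_vec (move_unit u v 1 a, b) + (ev u - ev v).
Proof.
rewrite (to_vec_vertex _ (move_unit u v 1 a)); congr (_ + _).
transitivity (\sum_y (((1 : int) *+ (y == u))%:~R *: ev y - ((1 : int) *+ (y == v))%:~R *: ev y)).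
  apply: eq_bigr => y _; rewrite -scalerBl -rmorphB ffunE; congr (_%:~R *: _).
  by ring.
by rewrite big_split sumrN /= !sum_delta_vec !scale1r.
Qed.

(** Unlike [in_dilate], it lets generators be added one at a time without renormalising. *)
Definition in_cone (t : R) (y : 'rV[R]_(n + m)) : Prop :=
  exists lam : 'I_(size (cosmo_points R ends)) -> R,
    [/\ forall i, 0 <= lam i, \sum_i lam i = t &
        y = \sum_i lam i *: (cosmo_points R ends)`_i].

Lemma in_cone_add t y g : g \in cosmo_points R ends -> in_cone t y -> in_cone (t + 1) (y + g).
Proof.
move=> gS [lam [lam0 lamt ->]].
have iS : (index g (cosmo_points R ends) < size (cosmo_points R ends))%N by rewrite index_mem.
exists (fun i => lam i + (i == Ordinal iS)%:R); split=> [i||].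
- by rewrite addr_ge0.
- rewrite big_split lamt /=; congr (_ + _).
  by rewrite (bigD1 (Ordinal iS)) //= eqxx big1 ?addr0 // => i /negbTE ->.
- under [RHS]eq_bigr do rewrite scalerDl.
  rewrite big_split /=; congr (_ + _).
  rewrite (bigD1 (Ordinal iS)) //= eqxx scale1r nth_index // big1 ?addr0 //.
  by move=> i /negbTE ->; rewrite scale0r.
Qed.

Lemma cosmo_pointsP g : reflect
  [\/ exists f, g = ee f, exists f, g = e_tilde R ends f,
      exists f, g = e_left R ends f \/ g = e_right R ends f | exists u, g = ev u]
  (g \in cosmo_points R ends).
Proof.
rewrite !mem_cat; apply: (iffP idP).
  case/or4P=> [/mapP[f _ ->]|/mapP[f _ ->]|/mapP[f _ ->]|/orP[]/mapP[f _ ->]].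
  - by constructor 1; exists f.
  - by constructor 2; exists f.
  - by constructor 3; exists f; left.
  - by constructor 3; exists f; right.
  - by constructor 4; exists f.
case=> [[f ->]|[f ->]|[f [->|->]]|[u ->]]; rewrite map_f ?mem_enum ?orbT //.
Qed.

Lemma slack_add_edge f t a b S : slack ends a (add_edge f t (a, b)).2 S =
  slack ends a b S + (pos_part (b f + t) - pos_part (b f)) *+ separates ends f S.
Proof.
rewrite /slack -addrA; congr (_ + _).
rewrite -(sum_delta (fun f => separates ends f S)) -big_split /=.
apply: eq_bigr => g _; rewrite ffunE; have [->|_] := eqVneq g f.
  by rewrite !mulr1n addrC subrK.
by rewrite !addr0.
Qed.

Lemma degree_add_edge f t x : degree (add_edge f t x) = degree x + `|x.2 f + t| - `|x.2 f|.
Proof.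
rewrite /degree /= -!addrA; congr (_ + _).
rewrite (bigD1 f) //= [in RHS](bigD1 f) //= ffunE eqxx mulr1n.
rewrite addrC [`|x.2 f| + _]addrC -!addrA [`|x.2 f| + _]addrC subrK; congr (_ + _).
by apply: eq_bigr => g /negbTE gf; rewrite ffunE gf addr0.
Qed.

(** Only sets T with u but not v lose a unit. Neither the union nor the intersection of S and T
    separates u from v, so submodularity bounds the slack of T below by minus that of S, hence by
    1. *)
Lemma slack_move_ge0 u v a b (S : {set 'I_n}) :
  (forall T : {set 'I_n}, 0 <= slack ends a b T + ((u \in T) (+) (v \in T))%:Z) ->
  v \in S -> u \notin S -> slack ends a b S < 0 ->
  forall T, 0 <= slack ends (move_unit u v 1 a) b T.
Proof.
move=> H vS uS S0 T; rewrite slack_move; have := H T.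
case uT: (u \in T); case vT: (v \in T) => /=; rewrite ?mulr1n ?mulr0n; try lia.
move=> _; have := slack_submod ends a b S T.
have := H (S :|: T); have := H (S :&: T).
by rewrite !inE uT vT vS (negbTE uS) /=; lia.
Qed.

(** The full set makes both sums nonnegative, so b = 0; singletons then give a >= 0. *)
Lemma degree0 x : (forall S, 0 <= slack ends x.1 x.2 S) -> degree x = 0 ->
  x = ([ffun => 0], [ffun => 0]).
Proof.
case: x => a b H; rewrite /degree /= => deg.
have a0 := H setT; rewrite slack_setT in a0.
have b0 : 0 <= \sum_f `|b f| by apply: sumr_ge0.
move/eqP: deg; rewrite paddr_eq0 // => /andP[/eqP sa /eqP sb].
have bE : b = [ffun => 0].
  apply/ffunP => f; rewrite ffunE; apply/eqP; rewrite -normr_eq0; apply/eqP.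
  exact: (psumr_eq0P (fun f _ => normr_ge0 (b f)) sb).
have slackE S : slack ends a b S = \sum_(y in S) a y.
  by rewrite /slack [X in _ + X]big1 ?addr0 // => f _; rewrite bE ffunE.
have aE : a = [ffun => 0].
  have ay y : 0 <= a y by have := H [set y]; rewrite slackE big_set1.
  by apply/ffunP => y; rewrite ffunE; apply: (psumr_eq0P (fun y _ => ay y) sa).
by rewrite aE bE.
Qed.

Lemma to_vec0 : to_vec ([ffun => 0], [ffun => 0]) = 0.
Proof.
rewrite /to_vec !big1 ?addr0 // => i _; rewrite ffunE ?scale0r //.
by rewrite /edge_vec !scale0r addr0.
Qed.

Lemma peel_generator j x :
  (forall S, 0 <= slack ends x.1 x.2 S) -> degree x = j.+1%:Z ->
  exists y, [/\ forall S, 0 <= slack ends y.1 y.2 S, degree y = j%:Z &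
    exists2 g, g \in cosmo_points R ends & to_vec x = to_vec y + g].
Proof.
case: x => a b H deg.
case: (pickP (fun f => b f < 0)) => [f bf|bpos].
  exists (add_edge f 1 (a, b)); split=> [S||].
  - rewrite slack_add_edge /pos_part.
    have -> : (if 0 <= b f then b f else 0) = 0 by case: ifP; lia.
    have -> : (if 0 <= b f + 1 then b f + 1 else 0) = 0 by case: ifP; lia.
    by rewrite subr0 mul0rn addr0.
  - by rewrite degree_add_edge deg /=; lia.
  exists (e_tilde R ends f); first by apply/cosmo_pointsP; constructor 2; exists f.
  have negE : neg_part (b f + 1) - neg_part (b f) = -1.
    by rewrite /neg_part /pos_part; do 2 case: ifP; lia.
  rewrite to_vec_add_edge [(a, b).2]/= negE /e_tilde rmorphN1 rmorph1 scale1r scaleN1r.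
  by move: (to_vec _) (ev _ + _) (ee _) => X Y Z; rewrite addrA subrK addrK.
case: (pickP (fun f => 0 < b f)) => [f bf|bneg].
  set u := (ends f).1; set v := (ends f).2.
  (* Lowering a positive b_f by 1 costs one unit exactly on the sets separating f. If all slacks
     survive, [ee f] is peeled off. *)
  have posE : pos_part (b f - 1) - pos_part (b f) = -1.
    by rewrite /pos_part; do 2 case: ifP; lia.
  pose b' := (add_edge f (-1) (a, b)).2.
  have slackE S : slack ends a b S = slack ends a b' S + ((u \in S) (+) (v \in S))%:Z.
    by rewrite slack_add_edge posE /separates -/u -/v; case: (_ (+) _) => /=; lia.
  have H' S : 0 <= slack ends a b' S + ((u \in S) (+) (v \in S))%:Z by rewrite -slackE.
  have degE : degree (a, b') = j.
    by have := degree_add_edge f (-1) (a, b); rewrite deg /= => ->; lia.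
  have vecE : to_vec (a, b) = to_vec (a, b') + ee f.
    have := to_vec_add_edge f (-1) (a, b); rewrite -/b' /= => E.
    have negE : neg_part (b f - 1) - neg_part (b f) = 0.
      by rewrite /neg_part /pos_part; do 2 case: ifP; lia.
    move: E; rewrite negE scale0r addr0 rmorphN1 scaleN1r.
    by rewrite [add_edge _ _ _]surjective_pairing -/b' /= => ->; rewrite subrK.
  have [pos|] := boolP [forall S, 0 <= slack ends a b' S].
    exists (a, b'); split=> //; first exact/forallP.
    by exists (ee f) => //; apply/cosmo_pointsP; constructor 1; exists f.
  (* A violated set contains exactly one end of f; which end decides between the two arrow
     generators. *)
  rewrite negb_forall => /existsP[S]; rewrite -ltNge => S0.
  have := H' S; case uS: (u \in S); case vS: (v \in S) => /=; try lia; move=> _.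
    exists (move_unit v u 1 a, b'); split=> [T||].
    - apply: slack_move_ge0 uS (negbT vS) S0 T => T.
      by rewrite addbC.
    - by rewrite /degree /= sum_move.
    exists (e_right R ends f); first by apply/cosmo_pointsP; constructor 3; exists f; right.
    by rewrite vecE (to_vec_move v u) /e_right -/u -/v -addrA [ev v - _]addrC.
  exists (move_unit u v 1 a, b'); split=> [T||].
  - exact: slack_move_ge0 vS (negbT uS) S0 T.
  - by rewrite /degree /= sum_move.
  exists (e_left R ends f); first by apply/cosmo_pointsP; constructor 3; exists f; left.
  by rewrite vecE (to_vec_move u v) /e_left -/u -/v -addrA.
(* No edge coordinate is left, so a is nonnegative and a vertex generator can be peeled off. *)
have b0 f : b f = 0 by have := bpos f; have := bneg f; lia.
have slackE a' S : slack ends a' b S = \sum_(y in S) a' y.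
  by rewrite /slack [X in _ + X]big1 ?addr0 // => f _; rewrite b0.
have apos y : 0 <= a y by have := H [set y]; rewrite slackE big_set1.
case: (pickP (fun y => 0 < a y)) => [y ay|aneg]; last first.
  move: deg; rewrite /degree /= !big1 ?addr0 // => [f _|y _]; first by rewrite b0.
  by have := aneg y; have := apos y; lia.
pose a' := [ffun z => a z + (-1) *+ (z == y)].
exists (a', b); split=> [S||].
- rewrite slackE; apply: sumr_ge0 => z _; rewrite ffunE.
  by have [->|_] := eqVneq z y; have := apos z; rewrite ?mulr1n ?mulr0n; lia.
- rewrite /degree /=; under [\sum_z a' z]eq_bigr do rewrite ffunE.
  rewrite big_split /= (sum_delta predT) mulr1n addrAC.
  have -> : \sum_z a z + \sum_f `|b f| = j.+1%:Z := deg.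
  by rewrite -addn1 PoszD addrK.
exists (ev y); first by apply/cosmo_pointsP; constructor 4; exists y.
rewrite (to_vec_vertex _ a'); congr (_ + _).
rewrite -[RHS](scale1r (ev y)) -(sum_delta_vec 1); apply: eq_bigr => z _.
by rewrite ffunE; congr (_%:~R *: _); ring.
Qed.

Lemma in_cone_of_slack j x :
  (forall S, 0 <= slack ends x.1 x.2 S) -> degree x = j%:Z -> in_cone j%:R (to_vec x).
Proof.
elim: j x => [|j IH] x H deg.
  exists (fun=> 0); split=> //; first by rewrite big1.
  by rewrite (degree0 H deg) to_vec0 big1 // => i _; rewrite scale0r.
have [y [Hy degy [g gS ->]]] := peel_generator H deg.
by rewrite -natr1; apply: in_cone_add gS (IH y Hy degy).
Qed.

Lemma in_dilate_cone j y : (0 < n)%N ->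
  in_cone j%:R y -> in_dilate (cosmo_points R ends) j y.
Proof.
move=> n0 [lam [lam0 lamj ->]].
have S0 : (0 < size (cosmo_points R ends))%N.
  by rewrite -has_predT; apply/hasP; exists (ev (Ordinal n0)) => //;
    apply/cosmo_pointsP; constructor 4; exists (Ordinal n0).
(* For j = 0 all weights vanish, but [in_dilate] still asks for some point of the polytope, here its
   first generator. *)
case: j lamj => [|j] lamj.
  exists ((cosmo_points R ends)`_0); last first.
    rewrite scale0r big1 // => i _.
    have /eqP := lamj; rewrite psumr_eq0 => [|k _]; last exact: lam0.
    by move=> /allP /(_ i); rewrite mem_index_enum => /(_ isT) /eqP ->; rewrite scale0r.
  exists (fun i => (i == Ordinal S0)%:R); split=> [i|]; first exact: ler0n.
  split; rewrite (bigD1 (Ordinal S0)) //= ?eqxx big1 ?addr0 ?scale1r // => i /negbTE -> //.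
  by rewrite scale0r.
have j0 : j.+1%:R != 0 :> R by rewrite pnatr_eq0.
exists (j.+1%:R^-1 *: \sum_i lam i *: (cosmo_points R ends)`_i).
  exists (fun i => j.+1%:R^-1 * lam i); split=> [i|].
    by rewrite mulr_ge0 // invr_ge0 ler0n.
  rewrite -mulr_sumr lamj mulVf //; split=> //.
  by rewrite scaler_sumr; apply: eq_bigr => i _; rewrite scalerA.
by rewrite scalerA mulfV // scale1r.
Qed.

(** * Supporting functionals *)

Definition functional (p : 'I_n -> int) (q : 'I_m -> int) : 'cV[R]_(n + m) :=
  \col_k (match split k with inl u => p u | inr f => q f end)%:~R.

Lemma ev_functional p q u : ev u *m functional p q = (p u)%:~R%:M.
Proof.
rewrite -rowE; apply/matrixP => i k; rewrite !mxE !ord1 eqxx mulr1n.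
by case: splitP => [v /= /val_inj <-|f /= E] //; have := ltn_ord u; rewrite E; lia.
Qed.

Lemma ee_functional p q f : ee f *m functional p q = (q f)%:~R%:M.
Proof.
rewrite -rowE; apply/matrixP => i k; rewrite !mxE !ord1 eqxx mulr1n.
case: splitP => [v /= E|g /= /eqP]; first by have := ltn_ord v; rewrite -E; lia.
by rewrite eqn_add2l => /eqP /val_inj ->.
Qed.

Definition fE := (ev_functional, ee_functional, mulmxDl, mulNmx, mulmxBl).

(** Evaluated on the generators of an edge, nonnegativity amounts to the triangle inequalities for
    the two vertex weights and the edge weight. *)
Lemma functional_ge0 p q :
  (forall u, 0 <= p u) -> (forall f, 0 <= q f) ->
  (forall f, q f <= p (ends f).1 + p (ends f).2) ->
  (forall f, p (ends f).1 <= p (ends f).2 + q f) ->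
  (forall f, p (ends f).2 <= p (ends f).1 + q f) ->
  forall g, g \in cosmo_points R ends -> 0 <= (g *m functional p q) 0 0.
Proof.
move=> p0 q0 tri1 tri2 tri3 g /cosmo_pointsP[[f ->]|[f ->]|[f [->|->]]|[u ->]].
- by rewrite fE !mxE eqxx mulr1n ler0z.
- by rewrite !fE !mxE eqxx !mulr1n -rmorphD -rmorphB ler0z; have := tri1 f; lia.
- by rewrite !fE !mxE eqxx !mulr1n -rmorphB -rmorphD ler0z; have := tri3 f; lia.
- by rewrite !fE !mxE eqxx !mulr1n -rmorphN -!rmorphD ler0z; have := tri2 f; lia.
- by rewrite fE !mxE eqxx mulr1n ler0z.
Qed.

Lemma to_vec_functional p q x : (to_vec x *m functional p q) 0 0 =
  (\sum_y x.1 y * p y +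
   \sum_f (x.2 f * q f + neg_part (x.2 f) * (p (ends f).1 + p (ends f).2)))%:~R.
Proof.
rewrite /to_vec mulmxDl !mulmx_suml mxE !summxE rmorphD !rmorph_sum /=.
congr (_ + _); apply: eq_bigr => i _.
  by rewrite -scalemxAl fE !mxE eqxx mulr1n -rmorphM.
rewrite /edge_vec mulmxDl -!scalemxAl !fE !mxE eqxx !mulr1n.
by rewrite -!rmorphD -!rmorphM -rmorphD.
Qed.

Lemma in_dilate_functional j y (W : 'cV[R]_(n + m)) :
  in_dilate (cosmo_points R ends) j y ->
  exists lam : 'I_(size (cosmo_points R ends)) -> R,
  [/\ forall i, 0 <= lam i, \sum_i lam i = 1 &
    (y *m W) 0 0 = j%:R * \sum_i lam i * ((cosmo_points R ends)`_i *m W) 0 0 :> R].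
Proof.
case=> p [lam [lam0 [lam1 ->]]] ->; exists lam; split=> //.
rewrite -scalemxAl mxE mulmx_suml summxE; congr (_ * _); apply: eq_bigr => i _.
by rewrite -scalemxAl mxE.
Qed.

Lemma in_dilateP j x : (0 < n)%N ->
  in_dilate (cosmo_points R ends) j (to_vec x) <->
  points ends (fun=> 0) setT (enum 'I_m) j x.
Proof.
move=> n0; rewrite points_setT; split; last first.
  by case/andP=> /forallP H /eqP deg; apply: in_dilate_cone => //; apply: in_cone_of_slack.
move=> D; apply/andP; split.
  apply/forallP => S.
  pose p u : int := (u \in S)%:Z.
  (* The functional depends on x: on edges with negative coordinate, q is chosen to vanish on
     [e_tilde f], so the value at [to_vec x] is exactly the slack of S. *)
  pose q f : int := if x.2 f < 0 then p (ends f).1 + p (ends f).2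
                    else (separates ends f S)%:Z.
  have slackE : slack ends x.1 x.2 S = \sum_y x.1 y * p y +
     \sum_f (x.2 f * q f + neg_part (x.2 f) * (p (ends f).1 + p (ends f).2)).
    rewrite /slack (big_mkcond (fun y => y \in S)) (big_mkcond (fun f => separates ends f S)) /=.
    congr (_ + _); apply: eq_bigr => i _; first by rewrite /p; case: (i \in S); lia.
    rewrite /q /neg_part /pos_part oppr_ge0; case: ltrgt0P => [x0|x0|->] /=.
    - by case: separates => /=; lia.
    - by rewrite if_same; ring.
    - by rewrite if_same; ring.
  have [lam [lam0 _]] := in_dilate_functional (functional p q) D.
  rewrite to_vec_functional -slackE => E.
  rewrite -(ler0z R) E mulr_ge0 ?ler0n // sumr_ge0 // => i _.
  rewrite mulr_ge0 //; apply: functional_ge0; last exact: mem_nth.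
  - by move=> u; rewrite /p.
  - by move=> f; rewrite /q /p; case: ifP => _; lia.
  - move=> f; rewrite /q /separates /p; case: ifP => _ //.
    by do 2 case: (_ \in S).
  - move=> f; rewrite /q /separates /p; case: ifP => _.
      by do 2 case: (_ \in S).
    by do 2 case: (_ \in S).
  - move=> f; rewrite /q /separates /p; case: ifP => _.
      by do 2 case: (_ \in S).
    by do 2 case: (_ \in S).
(* The coordinate sum is 1 on every generator, which pins the degree to j. *)
have [lam [_ lam1]] := in_dilate_functional (functional (fun=> 1) (fun=> 1)) D.
rewrite to_vec_functional; under [X in _ = _ * X]eq_bigr => i _.
  have -> : ((cosmo_points R ends)`_i *m functional (fun=> 1) (fun=> 1)) 0 0 = 1.
    have /cosmo_pointsP[[f ->]|[f ->]|[f [->|->]]|[u ->]] := mem_nth 0 (ltn_ord i);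
    by rewrite !fE !mxE eqxx !mulr1n; ring.
  rewrite mulr1; over.
rewrite lam1 mulr1 pmulrn => /intr_inj E; rewrite -E /degree; apply/eqP.
congr (_ + _); apply: eq_bigr => i _; first by rewrite mulr1.
by rewrite /neg_part /pos_part; case: ifP; lia.
Qed.

(** * Lattice points under the change of coordinates *)

Definition of_vec (z : 'rV[int]_(n + m)) : pt :=
  ([ffun u => z 0 (lshift m u) - \sum_f neg_part (z 0 (rshift n f)) *
      ((u == (ends f).1)%:Z + (u == (ends f).2)%:Z)],
   [ffun f => z 0 (rshift n f)]).

Definition to_ivec x : 'rV[int]_(n + m) :=
  \row_k match split k with
    | inl u => x.1 u + \sum_f neg_part (x.2 f) * ((u == (ends f).1)%:Z + (u == (ends f).2)%:Z)
    | inr f => x.2 f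
    end.

Lemma to_ivec_l x u : to_ivec x 0 (lshift m u) =
  x.1 u + \sum_f neg_part (x.2 f) * ((u == (ends f).1)%:Z + (u == (ends f).2)%:Z).
Proof. by rewrite mxE (unsplitK (inl u)). Qed.

Lemma to_ivec_r x f : to_ivec x 0 (rshift n f) = x.2 f.
Proof. by rewrite mxE (unsplitK (inr f)). Qed.

Lemma to_ivecK : cancel to_ivec of_vec.
Proof.
case=> a b; congr pair; apply/ffunP => i; rewrite ffunE ?to_ivec_l ?to_ivec_r //=.
by under [X in _ - X]eq_bigr do rewrite to_ivec_r; rewrite addrK.
Qed.

Lemma of_vecK : cancel of_vec to_ivec.
Proof.
move=> z; apply/rowP => k; rewrite -(splitK k); case: (split k) => i /=.
  rewrite to_ivec_l /= ffunE; under [X in _ + X]eq_bigr do rewrite ffunE.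
  by rewrite subrK.
by rewrite to_ivec_r /= ffunE.
Qed.

Lemma map_to_ivec x : map_mx intr (to_ivec x) = to_vec x.
Proof.
apply/rowP => k; rewrite -(splitK k) mxE; case: (split k) => i /=.
  rewrite to_ivec_l rmorphD rmorph_sum mxE !summxE /=; congr (_ + _).
    rewrite (bigD1 i) //= !mxE !eqxx mulr1 big1 ?addr0 // => y yi.
    by rewrite !mxE eq_lshift [i == y]eq_sym (negbTE yi) mulr0.
  apply: eq_bigr => f _; rewrite !mxE eq_lrshift !eq_lshift /= mulr0 add0r.
  by rewrite rmorphM rmorphD.
rewrite to_ivec_r mxE !summxE /= big1 ?add0r => [|y _]; last first.
  by rewrite !mxE eq_rlshift mulr0.
rewrite (bigD1 i) //= !mxE !eq_rlshift !eqxx mulr1 addr0 mulr0 addr0 big1 ?addr0 // => f fi.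
by rewrite !mxE !eq_rlshift eq_rshift [i == f]eq_sym (negbTE fi) /= addr0 !mulr0 addr0.
Qed.

Lemma dim_p1_cosmo : (0 < n)%N -> dim_p1 (cosmo_points R ends) = (n + m)%N.
Proof.
move=> n0; apply: (dim_p1_full (W := functional (fun=> 1) (fun=> 1))) => [|k|g].
- by rewrite addn_gt0 n0.
- rewrite -(splitK k); case: (split k) => i; apply/cosmo_pointsP.
    by constructor 4; exists i.
  by constructor 1; exists i.
- by case/cosmo_pointsP=> [[f ->]|[f ->]|[f [->|->]]|[u ->]];
    apply/matrixP => i k; rewrite !fE !mxE !ord1 eqxx !mulr1n; ring.
Qed.

End Cone.

Unset Implicit Arguments.

Theorem mainTheorem16 (R : realType) (n m : nat)
    (ends : 'I_m -> 'I_n * 'I_n) (mu : {set 'I_m} -> int) :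
  (0 < n)%N ->
  mobius_from0 (bridgeless ends) mu ->
  is_hstar (cosmo_points R ends)
    (\sum_(H : {set 'I_m} | bridgeless ends H)
        mu H *: (('X *+ 2) ^+ #|H| * (1 + 'X *+ 3) ^+ (m - #|H|))).
Proof.
move=> n0 mob; rewrite mobius_hstar //.
have endsT f : ((ends f).1 \in [set: 'I_n]) && ((ends f).2 \in [set: 'I_n]).
  by rewrite !inE.
have [E [uE mE hE]] := points_enum (enum_uniq 'I_m) endsT.
exists (fun j => size (E j)); split=> [j|k].
  (* The coordinate change is a bijection of lattice points, so the enumeration in the coordinates
     (a, b) counts the dilates. *)
  exists (map (to_ivec ends) (E j)); split; last by rewrite size_map.
    by rewrite map_inj_uniq //; apply: can_inj (to_ivecK ends).
  move=> x; rewrite -(of_vecK ends x) mem_map; last exact: can_inj (to_ivecK ends).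
  by rewrite mE map_to_ivec; apply: iff_sym; apply: in_dilateP.
by rewrite dim_p1_cosmo // -hE cardsT card_ord size_enum_ord series_act_exp_1subX.
Qed.
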